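(* For every $\varepsilon>0$ there exists $c=c(\varepsilon)>0$ such that the following holds. Let $G$ be an $n$-vertex ordered graph with no induced monotone path $P_5$ whose complement satisfies $\varrho_3(\overline{G})>\varepsilon$. Then $\overline{G}$ contains a copy of $K_2\big[\tfrac{cn}{\log n}\big]$.
   Context: All graphs are finite and simple. An ordered graph is a graph with a total ordering $<$ on its vertex set. A monotone path $P_k$ is an ordered graph with vertices $v_1<v_2<\dots<v_k$ in which $v_i,v_j$ are adjacent if and only if $|i-j|=1$; an ordered graph $G$ has no induced monotone $P_k$ if there are no vertices $v_1<\dots<v_k$ of $G$ such that $v_iv_j\in E(G)$ if and only if $|i-j|=1$. $\overline{G}$ is the complement of $G$. $\varrho_r(G)$ is the number of copies of $K_r$ in $G$ divided by $\binom{|V(G)|}{r}$. $H[t]$ is the $t$-blowup of $H$, obtained by replacing each vertex by an independent set of size $t$ and each edge by a copy of $K_{t,t}$; so $K_2[t]=K_{t,t}$. Containing a copy means as a not necessarily induced subgraph. Floor signs are omitted: for non-integer $t$, read $\lfloor t\rfloor$. *)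

(* Defs.v *)
From mathcomp Require Import all_boot all_order all_algebra.
From mathcomp Require Import reals exp.

Set Implicit Arguments.
Unset Strict Implicit.
Unset Printing Implicit Defensive.

Import Order.TTheory GRing.Theory Num.Theory.
Local Open Scope ring_scope.

(* A finite simple graph is given by its adjacency relation on a finType. *)
Definition simple_graph (V : finType) (e : rel V) : Prop :=
  symmetric e /\ irreflexive e.

Definition compl_graph (V : finType) (e : rel V) : rel V :=
  fun x y => (x != y) && ~~ e x y.

Definition complete_graph (r : nat) : rel 'I_r := fun i j => i != j.
Arguments complete_graph r : clear implicits.

Definition blowup (W : finType) (h : rel W) (t : nat) : rel (W * 'I_t) :=
  fun x y => h x.1 y.1.
Arguments blowup {W} h t.

(* Not necessarily induced: non-edges of h are unconstrained. *)
Definition contains_copy (V W : finType) (e : rel V) (h : rel W) : Prop :=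
  exists f : W -> V,
    injective f /\ (forall x y : W, h x y -> e (f x) (f y)).

(* Copies are counted as subgraphs, i.e. as vertex sets, not as labelled
   embeddings. *)
Definition cliques (V : finType) (e : rel V) (r : nat) : {set {set V}} :=
  [set A : {set V} | (#|A| == r) &&
    [forall x in A, forall y in A, (x != y) ==> e x y]].

(* The value is 0 when #|V| < r, by the convention x / 0 = 0. *)
Definition clique_density (R : realType) (V : finType) (e : rel V) (r : nat)
  : R := #|cliques e r|%:R / 'C(#|V|, r)%:R.

(* An ordered graph is a simple graph whose vertex type is a finOrderType. *)
Definition has_induced_monotone_path (d : Order.disp_t) (V : finOrderType d)
    (e : rel V) (k : nat) : Prop :=
  exists v : 'I_k -> V,
    (forall i j : 'I_k, (i < j)%N -> (v i < v j)%O) /\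
    (forall i j : 'I_k, e (v i) (v j) <-> `|(i : nat)%:Z - (j : nat)%:Z| = 1).

(* Main.v *)
Require Import Defs.
From mathcomp Require Import all_boot all_order all_algebra.
From mathcomp Require Import reals exp.
From mathcomp Require Import zify ring.

(** Orient every edge of [G] forwards, and suppose that the complement has no
biclique of size [t]. Then a vertex whose forward paths inside a set [S] hit [t]
elements of [S] hits all but [t] of the later ones. Halving a set of [t]
vertices [log n] times, each time skipping [2t] elements of [S], shows that all
but a small proportion of the pairs [u < z], [z] in [S], are joined by a
monotone path inside [S]; the skipped [t log n] elements are a small proportion
of the [n] vertices.

Take an independent triple [u < z < w], and let [u'] be a neighbour of [u]
below [u] which is adjacent to neither [z] nor [w]. Typically [u] reaches [z]
avoiding the neighbours of [u'] and [w], and [z] reaches [w] avoiding the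
neighbours of [u'] and [u]. If [a] is the last neighbour of [u] on the first
path, then a path from [a] to [w] avoids the neighbours of [u'] and [u], and
[a], [w] are not adjacent, so [u', u, a] extends to an induced monotone path on
five vertices. Hence the configurations [(u', u, z, w)] have small density, so
for some of the many pairs [(z, w)] the linearly many [u] that form a triple
with it induce few edges. Inside such a sparse set an induced path can be grown
greedily. *)

Set Implicit Arguments.
Unset Strict Implicit.
Unset Printing Implicit Defensive.

Import Order.TTheory GRing.Theory Num.Theory.

(** * Sums and cardinalities *)

Section Counting.

Variable V : finType.

Lemma leq_sum_nat_cst (F : V -> nat) c :
  (forall x, F x <= c) -> \sum_x F x <= #|V| * c.
Proof. by move=> h; rewrite -sum_nat_const; apply: leq_sum. Qed.

Lemma sum_nat_card (P : pred V) : \sum_x (P x : nat) = #|[set x | P x]|.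
Proof.
rewrite cardsE -sum1_card [RHS]big_mkcond; apply: eq_bigr => x _.
by case: ifP; rewrite unfold_in => ->.
Qed.

(** A Markov-type bound: a term is charged [c] when it exceeds [b], and [b] otherwise. *)
Lemma sum_nat_threshold (F : V -> nat) (b c : nat) :
  (forall x, F x <= c) ->
  \sum_x F x <= #|[set x | b < F x]| * c + #|V| * b.
Proof.
move=> h; rewrite -sum_nat_card big_distrl /= -sum_nat_const -big_split /=.
apply: leq_sum => x _; case: ltnP => hx /=; last by lia.
by have := h x; lia.
Qed.

End Counting.

(** * Positions and reachability inside a set *)

Section Reach.

Variables (V : finType) (f : rel V) (pos : V -> nat).
Hypothesis pos_inj : injective pos.
Hypothesis f_pos : forall x y, f x y -> pos x < pos y.

(** The starting vertex need not lie in [S]; only the later vertices of the path must. *)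
Definition reach (S : {set V}) : rel V := connect [rel x y | f x y && (y \in S)].

Definition out (x : V) : {set V} := [set y | f x y].

Definition tail (S : {set V}) p := #|[set x in S | p <= pos x]|.

Lemma tail0 S : tail S 0 = #|S|.
Proof. by rewrite /tail; congr #|pred_of_set _|; apply/setP => x; rewrite !inE andbT. Qed.

Lemma tail_succ S p : tail S p <= (tail S p.+1).+1.
Proof.
rewrite /tail; set A := [set x in S | p <= pos x].
set B := [set x in S | p.+1 <= pos x].
have -> : #|A| = #|B| + #|A :\: B|.
  rewrite -(cardsID B A); congr (#|pred_of_set _| + _).
  by apply/setP => x; rewrite !inE; case: (x \in S) => //=; lia.
suff: #|A :\: B| <= 1 by lia.
apply/card_le1P => x; rewrite !inE => hx y; rewrite !inE.
apply/idP/eqP => [hy | -> //].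
by apply: pos_inj; lia.
Qed.

Lemma tail_mono S p p' : p <= p' -> tail S p' <= tail S p.
Proof.
move=> h; apply: subset_leq_card; apply/subsetP => x; rewrite !inE.
by case/andP => -> h'; rewrite /=; lia.
Qed.

Lemma tail_setD (S A : {set V}) p : tail S p <= tail (S :\: A) p + #|A|.
Proof.
apply: leq_trans (leq_card_setU _ _).
apply: subset_leq_card; apply/subsetP => x; rewrite !inE.
by case: (x \in A); rewrite ?orbT ?orbF.
Qed.

(** By injectivity of [pos], raising the threshold by one loses at most one element, so [tail S]
    skips no value on its way down to 0. *)
Lemma tail_ivt S p k : k <= tail S p -> exists2 p', p <= p' & tail S p' = k.
Proof.
move=> hk.
have [N hN] : exists N, tail S N <= k.
  exists (\max_x pos x).+1; rewrite /tail.
  rewrite (_ : [set _ in _ | _] = set0) ?cards0 //.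
  apply/setP => x; rewrite !inE ltnNge.
  by rewrite (leq_bigmax x) andbF.
have [h|h] := leqP N p.
  by exists p => //; have := tail_mono S h; lia.
have : exists q, (p <= q) && (tail S q <= k) by exists N; rewrite hN andbT ltnW.
case/ex_minnP => q /andP[pq hq] hmin; exists q => //.
apply/eqP; rewrite eqn_leq hq /=.
case: q pq hq hmin => [|q] pq hq hmin; first by move: hk; have -> : p = 0 by lia.
have [e|ne] := eqVneq p q.+1; first by rewrite -e.
rewrite leqNgt; apply/negP => hlt.
by have := hmin q; have := tail_succ S q; lia.
Qed.

Lemma reach_refl S x : reach S x x. Proof. exact: connect0. Qed.

Lemma reach_trans S : transitive (reach S). Proof. exact: connect_trans. Qed.

Lemma reach_step S x y z : reach S x y -> f y z -> z \in S -> reach S x z.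
Proof.
by move=> h fyz zS; apply: connect_trans h (connect1 _); rewrite /= fyz.
Qed.

Lemma reach_sub (S S' : {set V}) x y : S \subset S' -> reach S x y -> reach S' x y.
Proof.
move=> /subsetP h; apply: connect_sub => a b /=.
by case/andP => fab /h bS; apply: connect1; rewrite /= fab.
Qed.

Lemma reach_ind S x (P : V -> Prop) :
  P x -> (forall y z, reach S x y -> P y -> f y z -> z \in S -> P z) ->
  forall y, reach S x y -> P y.
Proof.
move=> Px IH y /connectP[p]; elim/last_ind: p y => [|p z IHp] y /=.
  by move=> _ ->.
rewrite rcons_path last_rcons => /andP[hp /andP[fz zS]] ->.
apply: IH fz zS; last by apply: IHp.
by apply/connectP; exists p.
Qed.

Lemma reach_pos S x y : reach S x y -> pos x <= pos y.
Proof.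
move: y; apply: reach_ind => [//|y z _ h /f_pos h' _]; lia.
Qed.

(* Take the last out-neighbour of [a] on the path. *)
Lemma reach_via_out S a x : reach S a x -> x != a ->
  exists2 b, b \in out a :&: S & reach (S :\: out a) b x.
Proof.
move: x; apply: reach_ind => [|y z _ IH fyz zS _]; first by rewrite eqxx.
have [faz|nfaz] := boolP (f a z).
  by exists z; rewrite ?inE ?faz ?zS ?reach_refl.
have ya : y != a by apply: contraNneq nfaz => <-.
have [b hb hr] := IH ya; exists b => //.
by apply: reach_step hr fyz _; rewrite !inE nfaz.
Qed.

(** The path cannot stop at the last out-neighbour [b] of [a], as [x] is not one; its next vertex
    [d] makes [a, b, d] an induced path. *)
Lemma reach_two_steps S a x : reach S a x -> x != a -> ~~ f a x ->
  exists b d, [/\ f a b, b \in S, f b d, d \in S & ~~ f a d].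
Proof.
move=> h xa nfax; have [b] := reach_via_out h xa.
rewrite !inE => /andP[fab bS] /connectP[[|d q] /= hp ex].
  by move: nfax; rewrite ex fab.
case/andP: hp => /andP[fbd]; rewrite !inE => /andP[nfad dS] _.
by exists b, d.
Qed.

(** * Expansion in the absence of bicliques *)

Variable t : nat.
Hypothesis t_gt0 : 0 < t.
Hypothesis no_biclique : forall A B : {set V}, t <= #|A| -> t <= #|B| ->
  (forall x y, x \in A -> y \in B -> pos x < pos y) ->
  exists x y, [/\ x \in A, y \in B & f x y].

Definition reached (T S : {set V}) p :=
  [set x in S | (pos x < p) && [exists v in T, reach S v x]].

Definition unreached (T S : {set V}) p :=
  [set x in S | (p <= pos x) && ~~ [exists v in T, reach S v x]].

(** By [unreached_lt], such a [v] misses fewer than [t] elements of [S] from position [p] on. *)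
Definition good v S p := t <= #|reached [set v] S p|.

(** An edge from a reached element to an unreached one would extend a path, so the two sets cannot
    both have [t] elements. *)
Lemma unreached_lt T S p : t <= #|reached T S p| -> #|unreached T S p| < t.
Proof.
move=> hA; rewrite ltnNge; apply/negP => hB.
have [|x [y [hx hy fxy]]] := no_biclique hA hB.
  by move=> x y; rewrite !inE => /and3P[_ h _] /and3P[_ h' _]; lia.
move: hx hy; rewrite !inE => /and3P[xS _ /existsP[v /andP[vT hv]]].
case/and3P => yS _ /existsP[]; exists v; rewrite vT /=.
exact: reach_step hv fxy yS.
Qed.

(** An element of [S] positioned in [[p, p')] is counted as reached at [p'] or as unreached at
    [p]. *)
Lemma tail_reached T S p p' : p <= p' ->
  tail S p + #|reached T S p| <=
  tail S p' + #|reached T S p'| + #|unreached T S p|.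
Proof.
move=> pp'.
have hdisj : #|reached T S p| + tail S p = #|reached T S p :|: [set x in S | p <= pos x]|.
  rewrite cardsU /tail.
  rewrite (_ : _ :&: _ = set0) ?cards0 ?subn0 //.
  by apply/setP => x; rewrite !inE; case: (x \in S) => //=; lia.
rewrite addnC hdisj.
apply: leq_trans (leq_trans (leq_card_setU _ _) (leq_add (leq_card_setU _ _) (leqnn _))).
apply: subset_leq_card; apply/subsetP => x; rewrite !inE.
by case: (x \in S) => //=; case: [exists _ in _, _]; rewrite ?andbT ?andbF; lia.
Qed.

Lemma reached_grow T S p p' : t <= #|reached T S p| -> p <= p' ->
  tail S p' + 2 * t <= tail S p -> 2 * t <= #|reached T S p'|.
Proof.
move=> h pp' ht; have := unreached_lt h; have := tail_reached T S pp'; lia.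
Qed.

Lemma reached_set0 S p : reached set0 S p = set0.
Proof.
apply/setP => x; rewrite !inE; apply/negbTE; rewrite !negb_and.
by rewrite negb_exists; apply/orP; right; apply/orP; right; apply/forallP => y; rewrite inE.
Qed.

Lemma reached_setU T1 T2 S p :
  #|reached (T1 :|: T2) S p| <= #|reached T1 S p| + #|reached T2 S p|.
Proof.
apply: leq_trans (leq_card_setU _ _); apply: subset_leq_card.
apply/subsetP => x; rewrite !inE => /and3P[-> -> /existsP[v]] /=.
rewrite inE => /andP[/orP[vT|vT] h]; apply/orP; [left|right];
  by apply/existsP; exists v; rewrite vT.
Qed.

(* While a block of [2 * t] elements of [S] is passed, the number of elements
   reached from [T] doubles to [2 * t], so one half of [T] still reaches [t]. *)
Lemma halving j (T S : {set V}) p : #|T| <= 2 ^ j -> t <= #|reached T S p| ->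
  2 * t * j <= tail S p ->
  exists v p', [/\ v \in T, p <= p', tail S p <= tail S p' + 2 * t * j &
    good v S p'].
Proof.
elim: j T p => [|j IH] T p hT hr htl.
  have : #|T| != 0.
    by apply: contraTneq hr => /cards0_eq ->; rewrite reached_set0 cards0 -ltnNge.
  move=> h0; have /cards1P[v eT] : #|T| == 1 by move: hT h0; rewrite expn0; lia.
  by exists v, p; rewrite eT inE; split => //; [lia | rewrite /good -eT].
pose T1 := [set x in take (2 ^ j) (enum T)].
pose T2 := [set x in drop (2 ^ j) (enum T)].
have eT : T = T1 :|: T2.
  by apply/setP => x; rewrite !inE -mem_cat cat_take_drop mem_enum.
have h1 : #|T1| <= 2 ^ j.
  rewrite cardsE; apply: leq_trans (card_size _) _.
  by rewrite size_take; case: ltnP.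
have h2 : #|T2| <= 2 ^ j.
  rewrite cardsE; apply: leq_trans (card_size _) _.
  by rewrite size_drop -cardE; move: hT; rewrite expnS; lia.
have [p0 pp0 ep0] := @tail_ivt S p (tail S p - 2 * t) (leq_subr _ _).
have hg : 2 * t <= #|reached T S p0| by apply: reached_grow hr pp0 _; nia.
have := reached_setU T1 T2 S p0; rewrite -eT => hU.
have [hr1|hr1] := leqP t #|reached T1 S p0|.
  have [|v [p' [vT pp' hp' gv]]] := IH _ _ h1 hr1; first by nia.
  by exists v, p'; rewrite eT inE vT; split => //; nia.
have [||v [p' [vT pp' hp' gv]]] := IH T2 p0 h2; [by lia|by nia|].
by exists v, p'; rewrite eT inE vT orbT; split => //; nia.
Qed.

Variable K : nat.
Hypothesis card_le : #|V| <= 2 ^ K.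

(** The number of elements skipped: [K] halvings and one initial block, [2 * t] for each. *)
Let q := 2 * t * K.+1.

Lemma card_le_pow (T : {set V}) : #|T| <= 2 ^ K.
Proof. exact: leq_trans (max_card _) card_le. Qed.

(** Single edges from [T] already hit all but fewer than [t] of the next [2 * t] elements of [S];
    halving then isolates one vertex. *)
Lemma exists_good (T S : {set V}) p : t <= #|T| -> (forall v, v \in T -> pos v < p) ->
  q <= tail S p ->
  exists v p', [/\ v \in T, p <= p', tail S p <= tail S p' + q & good v S p'].
Proof.
rewrite /q => hT hp hq.
have [p0 pp0 ep0] := @tail_ivt S p (tail S p - 2 * t) (leq_subr _ _).
pose U := [set x in S | (p <= pos x < p0) && ~~ [exists v in T, reach S v x]].
have hU : #|U| < t.
  rewrite ltnNge; apply/negP => hU.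
  have [|x [y [xT]]] := no_biclique hT hU.
    by move=> x y /hp h; rewrite !inE => /and3P[_ /andP[h' _] _]; lia.
  rewrite !inE => /and3P[yS _ /existsP nr] fxy; apply: nr; exists x; rewrite xT /=.
  exact: reach_step (reach_refl _ _) fxy yS.
have hr : t <= #|reached T S p0|.
  have: tail S p <= #|reached T S p0| + #|U| + tail S p0.
    apply: leq_trans (leq_trans (leq_card_setU _ _) (leq_add (leq_card_setU _ _) (leqnn _))).
    apply: subset_leq_card; apply/subsetP => x; rewrite !inE.
    by case: (x \in S) => //=; case: [exists _ in _, _]; rewrite ?andbT ?andbF; lia.
  by rewrite ep0; nia.
have [|v [p' [vT pp' hp' gv]]] := halving (card_le_pow T) hr; first by nia.
by exists v, p'; split => //; nia.
Qed.

(** Goodness provides a vertex reached before [p], so [pos v < p] and [x] differs from [v]. *)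
Lemma good_reach v S p x : good v S p -> x \in S -> p <= pos x ->
  x \notin unreached [set v] S p -> reach S v x /\ x != v.
Proof.
move=> gv xS px; rewrite !inE xS px /= negbK => /existsP[w /andP[]].
rewrite inE => /eqP -> h; split=> //.
have /card_gt0P[y] : 0 < #|reached [set v] S p| by apply: leq_trans gv.
rewrite !inE => /and3P[_ hy /existsP[w' /andP[]]]; rewrite inE => /eqP -> /reach_pos h'.
by apply: contraTneq px => ->; lia.
Qed.

(** Past its last vertex in [out a], a path from [a] avoids [out a]. Hence the out-neighbours of [a]
    jointly reach [t] of the next [2 * t] elements of [S :\: out a], and halving selects one of
    them. *)
Lemma good_step a S p : good a S p -> q <= tail (S :\: out a) p ->
  exists b p', [/\ b \in out a :&: S, p <= p',
    tail (S :\: out a) p <= tail (S :\: out a) p' + q & good b (S :\: out a) p'].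
Proof.
rewrite /q; set S1 := S :\: out a => ga hq.
have [p0 pp0 ep0] := @tail_ivt S1 p (tail S1 p - 2 * t) (leq_subr _ _).
have hU := unreached_lt ga.
have hr : t <= #|reached (out a :&: S) S1 p0|.
  have: tail S1 p <= #|reached (out a :&: S) S1 p0| + #|unreached [set a] S p| + tail S1 p0.
    apply: leq_trans (leq_trans (leq_card_setU _ _) (leq_add (leq_card_setU _ _) (leqnn _))).
    apply: subset_leq_card; apply/subsetP => x /setIdP[xS1 px].
    have [xp0|xp0] := leqP p0 (pos x); first by apply/setUP; right; rewrite inE xS1.
    apply/setUP; left; apply/setUP.
    have [xu|xu] := boolP (x \in unreached [set a] S p); [by right|left].
    have xS : x \in S by move: xS1; rewrite inE => /andP[].
    have [hre xa] := good_reach ga xS px xu.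
    have [b hb hb'] := reach_via_out hre xa.
    rewrite inE xS1 xp0 /=; apply/existsP; exists b; by rewrite hb.
  by rewrite ep0; nia.
have [|v [p' [vT pp' hp' gv]]] := halving (card_le_pow _) hr; first by nia.
by exists v, p'; split => //; nia.
Qed.

(** * Sparse sets contain an induced path *)

Hypothesis no_P5 : forall x1 x2 x3 x4 x5,
  f x1 x2 -> f x2 x3 -> f x3 x4 -> f x4 x5 ->
  ~~ f x1 x3 -> ~~ f x1 x4 -> ~~ f x1 x5 -> ~~ f x2 x4 -> ~~ f x2 x5 ->
  ~~ f x3 x5 -> False.

(* Greedily grow [u, a, b], each vertex reaching most of the common
   non-neighbourhood of its predecessors inside that common non-neighbourhood. *)
Lemma no_sparse_set (Q : {set V}) d :
  (forall x, x \in Q -> #|out x :&: Q| <= d) -> #|Q| <= 3 * d + 3 * q + 2 * t.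
Proof.
move=> hd; rewrite leqNgt; apply/negP => hQ.
have hout (S : {set V}) x p : x \in Q -> S \subset Q -> tail S p <= tail (S :\: out x) p + d.
  move=> xQ SQ; apply: leq_trans (tail_setD S (out x :&: Q) p) _.
  have -> : S :\: (out x :&: Q) = S :\: out x.
    apply/setP => y; rewrite !inE; have [yS|] := boolP (y \in S); last by rewrite !andbF.
    by rewrite (subsetP SQ _ yS) !andbT.
  by rewrite leq_add2l (hd _ xQ).
have [p _ ep] := @tail_ivt Q 0 (#|Q| - t) (leq_trans (leq_subr _ _) (eq_leq (esym (tail0 Q)))).
(* The first [t] elements of [Q] are the candidates for [u]. *)
pose T := [set x in Q | pos x < p].
have hT : t <= #|T|.
  have: #|Q| <= #|T| + tail Q p.
    apply: leq_trans (leq_card_setU _ _); apply: subset_leq_card.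
    by apply/subsetP => x xQ; rewrite !inE xQ /=; lia.
  by rewrite ep; lia.
have hTp v : v \in T -> pos v < p by rewrite inE => /andP[].
have [|u [p1 [uT _ h1 gu]]] := exists_good hT hTp (S := Q); first by lia.
have uQ : u \in Q by move: uT; rewrite inE => /andP[].
set S1 := Q :\: out u.
have S1Q : S1 \subset Q by apply: subsetDl.
have e1 := hout Q u p1 uQ (subxx _).
rewrite -/S1 in e1.
have [|a [p2 [aT _ h2 ga]]] := good_step gu; rewrite -/S1; first by lia.
rewrite -/S1 in h2 ga.
have [fua aQ] : f u a /\ a \in Q by move: aT; rewrite !inE => /andP[].
set S2 := S1 :\: out a.
have S2Q : S2 \subset Q by apply: subset_trans S1Q; apply: subsetDl.
have e2 := hout S1 a p2 aQ S1Q.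
rewrite -/S2 in e2.
have [|b [p3 [bT _ h3 gb]]] := good_step ga; rewrite -/S2; first by lia.
rewrite -/S2 in h3 gb.
have [fab bS1] : f a b /\ b \in S1 by rewrite inE in bT; case/andP: bT; rewrite inE.
have bQ := subsetP S1Q _ bS1.
have e3 := hout S2 b p3 bQ S2Q.
(* The candidates cost [t]; each of [u], [a], [b] costs [q] skipped elements and [d]
   out-neighbours. *)
have hs : t <= tail (S2 :\: out b) p3.
  move: ep h1 e1 h2 e2 h3 e3; clear -hQ; clearbody S1 S2 q; lia.
have : ~~ ([set x in S2 :\: out b | p3 <= pos x] \subset unreached [set b] S2 p3).
  apply/negP => /subset_leq_card hle.
  by have := leq_trans hs hle; rewrite leqNgt (unreached_lt gb).
case/subsetPn => x /setIdP[/setDP[xS2 nfbx] px] xu; rewrite inE in nfbx.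
have [hre xb] := good_reach gb xS2 px xu.
have [c [e [fbc cS2 fce eS2 nfbe]]] := reach_two_steps hre xb nfbx.
move: bS1 cS2 eS2; rewrite !inE => /andP[nub _] /and3P[nac nuc _] /and3P[nae nue _].
exact: (no_P5 fua fab fbc fce).
Qed.

(** * Counting missed pairs *)

Definition missed (S : {set V}) u z := [&& pos u < pos z, z \in S & ~~ reach S u z].

(** Fewer than [t] vertices before [p] miss more than [q + t] elements past [p]: among [t] of them,
    one would become good after [q] elements and miss fewer than [t] more. *)
Lemma missed_crossing (S : {set V}) p :
  \sum_u \sum_z (((pos u < p) && (p <= pos z) && missed S u z) : nat)
    <= #|V| * (q + 2 * t).
Proof.
pose F u := \sum_z (((pos u < p) && (p <= pos z) && missed S u z) : nat).
have hF u : F u <= #|V|.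
  rewrite /F sum_nat_card; exact: max_card.
have := sum_nat_threshold (q + t) hF.
set T := [set x | _].
suff : #|T| < t by rewrite /F; nia.
rewrite ltnNge; apply/negP => hT.
have hp v : v \in T -> pos v < p.
  rewrite inE; apply: contraTT; rewrite -leqNgt => h; rewrite -leqNgt /F big1 // => z _.
  by rewrite ltnNge h.
have hFt u : F u <= tail S p.
  rewrite /F sum_nat_card /tail; apply: subset_leq_card; apply/subsetP => z; rewrite !inE.
  by case/and3P => /andP[_ ->] _ /andP[-> _].
have [|v [p' [vT pp' h1 gv]]] := exists_good hT hp (S := S).
  have /card_gt0P[v] : 0 < #|T| by lia.
  by rewrite inE => h; have := hFt v; lia.
have := unreached_lt gv; move: vT; rewrite inE.
suff : F v + tail S p' <= tail S p + #|unreached [set v] S p'| by lia.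
rewrite /F sum_nat_card /tail.
(* Inclusion-exclusion on both sides leaves two inclusions, one for unions and one for
   intersections; a missed [z] past [p'] is unreached. *)
rewrite -[X in X <= _]cardsUI -[X in _ <= X]cardsUI.
apply: leq_add; apply: subset_leq_card; apply/subsetP => z; rewrite !inE.
  by rewrite /missed; case: (z \in S); rewrite ?andbT ?andbF //=; lia.
case/andP => /andP[/andP[_ pz] /and3P[_ zS nr]] /andP[_ p'z].
rewrite zS pz p'z /=; apply/existsP => -[w /andP[]]; rewrite inE => /eqP ->.
exact/negP.
Qed.

Hypothesis pos_lt : forall x, pos x < #|V|.

Lemma card_pos_window a b : #|[set z | a < pos z < a + b]| <= b.
Proof.
rewrite cardE -(size_map pos) -[leqRHS](size_iota a.+1 b).
apply: uniq_leq_size; first by rewrite map_inj_uniq ?enum_uniq.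
by move=> i /mapP[z]; rewrite mem_enum inE mem_iota => h ->; lia.
Qed.

(* A missed pair at distance at least [g] crosses one of the [M] multiples
   of [g]. *)
Lemma missed_sum (S : {set V}) M g : #|V| <= M * g ->
  \sum_u \sum_z (missed S u z : nat) <= #|V| * g + M * (#|V| * (q + 2 * t)).
Proof.
move=> hMg.
pose near u z := (pos u < pos z < pos u + g : nat).
pose cross u z i := ((pos u < i * g) && (i * g <= pos z) && missed S u z : nat).
have hsplit u z : (missed S u z : nat) <= near u z + \sum_(i < M) cross u z i.
  have [hm|//] := boolP (missed S u z).
  have [hn|hn] := boolP (pos u < pos z < pos u + g); first by rewrite /near hn.
  have uz : pos u < pos z by case/and3P: hm.
  have g0 : 0 < g by have := pos_lt z; nia.
  (* [i * g] is the first multiple of [g] above [pos u], hence at most [pos u + g], and so at most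
     [pos z]. *)
  pose i := (pos u %/ g).+1.
  have hu := divn_eq (pos u) g; have hu' := ltn_pmod (pos u) g0.
  have iM : i < M by have := pos_lt z; rewrite /i; nia.
  rewrite (bigD1 (Ordinal iM)) //= /cross hm andbT.
  have -> : pos u < i * g by rewrite /i; lia.
  have -> : i * g <= pos z by rewrite /i; lia.
  lia.
apply: (@leq_trans (\sum_u \sum_z (near u z + \sum_(i < M) cross u z i))).
  by apply: leq_sum => u _; apply: leq_sum.
under eq_bigr => u _ do rewrite big_split.
rewrite big_split /=; apply: leq_add.
  by apply: leq_sum_nat_cst => u; rewrite /near sum_nat_card card_pos_window.
under eq_bigr => u _ do rewrite exchange_big.
rewrite exchange_big /=.
apply: (@leq_trans (\sum_(i < M) #|V| * (q + 2 * t))); last by rewrite sum_nat_const card_ord.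
apply: leq_sum => i _.
exact: missed_crossing.
Qed.

(** * Independent triples *)

Definition indep3 u z w :=
  [&& pos u < pos z, pos z < pos w, ~~ f u z, ~~ f u w & ~~ f z w].

Lemma edge_indep3_missed u' u z w :
  f u' u -> indep3 u' z w -> indep3 u z w ->
  missed [set y | ~~ f u' y & ~~ f y w] u z ||
  missed [set y | ~~ f u' y & ~~ f u y] z w.
Proof.
set S1 := [set y | _ & _]; set S2 := [set y | _ & _].
move=> fu'u /and5P[_ _ nu'z nu'w _] /and5P[uz zw nuz nuw nzw].
rewrite /missed uz zw [z \in S1]inE [w \in S2]inE nu'z nu'w nuw nzw /=.
rewrite -negb_and; apply/negP => /andP[r1 r2].
have zu : z != u by apply: contraTneq uz => ->; rewrite ltnn.
have [a] := reach_via_out r1 zu; rewrite !inE => /and3P[fua nu'a naw] raz.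
(* Past [a] the first path also avoids [out u], so it lies in [S2] and the second path continues it
   to [w]. *)
have raw : reach S2 a w.
  apply: reach_trans r2; apply: reach_sub raz; apply/subsetP => y; rewrite !inE.
  by case/and3P => -> ->.
have wa : w != a by apply: contraTneq zw => ->; rewrite -leqNgt; apply: reach_pos raz.
have [b [c [fab + fbc + nac]]] := reach_two_steps raw wa naw.
rewrite !inE => /andP[nu'b nub] /andP[nu'c nuc].
exact: (no_P5 fu'u fua fab fbc).
Qed.

Definition apexes z w := [set u | indep3 u z w].

Definition edges (Q : {set V}) := \sum_(x in Q) #|out x :&: Q|.

(** The vertices of low out-degree in [Q] form a sparse set, which [no_sparse_set] bounds, so many
    vertices have high out-degree. *)
Lemma edges_lower m (Q : {set V}) : 0 < m -> 48 * m * (t * K.+2) <= #|V| ->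
  #|V| < 2 * m * #|Q| -> #|V| ^ 2 <= 96 * m ^ 2 * edges Q.
Proof.
move=> m0 hn hQ; rewrite leqNgt; apply/negP => hE.
set n := #|V| in hn hQ hE.
(* Both [3 * d] and [3 * q + 2 * t] are at most [n / (8 * m)], leaving more than [n / (4 * m)]
   vertices of out-degree above [d]; this gives [96 = 4 * 24]. *)
pose d := n %/ (24 * m).
have hd1 : 24 * m * d <= n by rewrite mulnC leq_divM.
have hd2 : n < 24 * m * d.+1 by rewrite mulnC ltn_ceil // muln_gt0.
pose H := [set x in Q | d < #|out x :&: Q|].
have hH : #|H| * d.+1 <= edges Q.
  rewrite -sum_nat_const /edges [leqRHS](big_setID H) /=.
  have -> : Q :&: H = H by apply/setIidPr/subsetP => x; rewrite inE => /andP[].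
  apply: leq_trans (leq_addr _ _); apply: leq_sum => x.
  by rewrite inE => /andP[].
have hs : #|Q :\: H| <= 3 * d + 3 * q + 2 * t.
  apply: no_sparse_set => x; rewrite !inE => /andP[+ xQ]; rewrite xQ /= -leqNgt => h.
  by apply: leq_trans h; apply: subset_leq_card; rewrite setIS // subsetDl.
have hHQ : #|Q| <= #|Q :\: H| + #|H|.
  by rewrite -(cardsID H Q) addnC leq_add2l subset_leq_card // subsetIr.
have hH' : 4 * m * #|H| <= n.
  move: hH hd2 hE; move: d.+1 #|H| (edges Q) (n); clear -m0 => d1 h e n hH hd2 hE.
  have h1 : h * n <= 24 * m * e by nia.
  have : 96 * m ^ 2 * (h * n) <= 24 * m * (96 * m ^ 2 * e) by nia.
  have : 24 * m * (96 * m ^ 2 * e) <= 24 * m * n ^ 2 by nia.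
  move=> h2 /leq_trans/(_ h2); nia.
move: hs hHQ hH' hd1 hn hQ; rewrite /q.
by move: (d) #|Q| #|H| #|Q :\: H| (n); clear => d x y z n; nia.
Qed.

(** An edge [u' u] among the apexes of [(z, w)] is charged to a missed pair [(u, z)] in a set fixed
    by [(u', w)], or to a missed pair [(z, w)] in a set fixed by [(u', u)]. Each kind has [#|V| ^ 2]
    parameter choices. *)
Lemma edges_upper c :
  (forall S : {set V}, \sum_u \sum_z (missed S u z : nat) <= c) ->
  \sum_z \sum_w edges (apexes z w) <= 2 * #|V| ^ 2 * c.
Proof.
move=> hc.
pose A z w u' u : nat := missed [set y | ~~ f u' y & ~~ f y w] u z.
pose B z w u' u : nat := missed [set y | ~~ f u' y & ~~ f u y] z w.
have hcc (G : V -> V -> nat) : (forall x y, G x y <= c) -> \sum_x \sum_y G x y <= #|V| ^ 2 * c.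
  move=> hG; rewrite -mulnn -mulnA.
  by apply: leq_sum_nat_cst => x; apply: leq_sum_nat_cst.
have hA : \sum_z \sum_w \sum_u' \sum_u A z w u' u <= #|V| ^ 2 * c.
  rewrite exchange_big; under eq_bigr => w _ do rewrite exchange_big.
  apply: hcc => w u'; rewrite exchange_big; exact: hc.
have hB : \sum_z \sum_w \sum_u' \sum_u B z w u' u <= #|V| ^ 2 * c.
  under eq_bigr => z _ do rewrite exchange_big.
  rewrite exchange_big; under eq_bigr => u' _.
    under eq_bigr => z _ do rewrite exchange_big.
    rewrite exchange_big; over.
  apply: hcc => u' u; exact: hc.
rewrite -mulnA mul2n -addnn; apply: leq_trans (leq_add hA hB).
rewrite -big_split; apply: leq_sum => z _; rewrite -big_split; apply: leq_sum => w _.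
rewrite -big_split /edges big_mkcond; apply: leq_sum => u' _ /=.
rewrite -big_split; case: ifP => //; rewrite inE => hu'.
rewrite -sum1_card big_mkcond; apply: leq_sum => u _ /=.
case: ifP => //; rewrite !inE => /andP[fu'u hu].
by have := edge_indep3_missed fu'u hu' hu; rewrite /A /B; lia.
Qed.

(** Otherwise at least [n ^ 2 / (2 * m)] pairs [(z, w)] have many apexes, and the edges these span
    by [edges_lower] exceed the bound of [edges_upper]. *)
Lemma few_indep3 m : 0 < m -> 32 * (384 * m ^ 3) ^ 2 * (t * K.+2) <= #|V| ->
  m * (\sum_z \sum_w #|apexes z w|) < #|V| ^ 3.
Proof.
move=> m0 hn; rewrite ltnNge; apply/negP => hTr.
pose n := #|V|; pose b := n %/ (2 * m).
have hb1 : 2 * m * b <= n by rewrite mulnC leq_divM.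
have hb2 : n < 2 * m * b.+1 by rewrite mulnC ltn_ceil // muln_gt0.
pose F (p : V * V) := #|apexes p.1 p.2|.
have := @sum_nat_threshold _ F b n (fun p => max_card _).
set P := #|_|; rewrite card_prod -/n => hP.
rewrite pair_bigA /= -/n in hTr.
have tK : 0 < t * K.+2 by rewrite muln_gt0 t_gt0.
have n0 : 0 < n.
  by apply: leq_trans hn; rewrite muln_gt0 tK andbT muln_gt0 expn_gt0 muln_gt0 expn_gt0 m0.
have hP' : n ^ 2 <= 2 * m * P.
  have : m * \sum_p F p <= m * (P * n + n * n * b) by rewrite leq_mul2l hP orbT.
  move=> /(leq_trans hTr); move: hb1 n0; move: (b) (n) (P); clear => b n P; nia.
have hlow : P * n ^ 2 <= 96 * m ^ 2 * \sum_z \sum_w edges (apexes z w).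
  rewrite pair_bigA /= big_distrr /= -sum_nat_const [leqRHS](bigID [in [set p | b < F p]]) /=.
  apply: leq_trans (leq_addr _ _); apply: leq_sum => p; rewrite inE => hp.
  apply: edges_lower => //.
    apply: leq_trans hn; rewrite leq_mul2r; apply/orP; right.
    have : m <= m ^ 3 by rewrite -{1}(expn1 m) leq_pexp2l.
    by move: m0; move: (m ^ 3); clear => x; rewrite -mulnn; nia.
  by apply: leq_trans hb2 _; rewrite leq_mul2l hp orbT.
(* [D] multiplies [2 * m] from the number of pairs, [96 * m ^ 2] from [edges_lower] and 2 from
   [edges_upper]. With this [g], near pairs account for about a quarter of [n ^ 2] in [hlu], and
   crossing pairs for at most another quarter. *)
pose D := 384 * m ^ 3; pose g := (n %/ (4 * D)).+1.
have D0 : 0 < D by rewrite muln_gt0 expn_gt0 m0.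
have hg1 : n <= 4 * D * g by rewrite mulnC ltnW // ltn_ceil // muln_gt0.
have hg2 : 4 * D * g <= n + 4 * D.
  by rewrite mulnSr leq_add2r mulnC leq_divM.
have hup := edges_upper (fun S => missed_sum S hg1).
have {hlow hup} hlu : n ^ 2 <= D * (n * g + 4 * D * (n * (q + 2 * t))).
  move: hlow hup; rewrite -/n; set C := n * g + _; set E := \sum_z _ => hlow hup.
  have n20 : 0 < n ^ 2 by rewrite expn_gt0 n0.
  rewrite -(leq_pmul2l n20).
  apply: (@leq_trans (2 * m * (P * n ^ 2))); first by rewrite mulnA leq_mul2r hP' orbT.
  apply: (@leq_trans (2 * m * (96 * m ^ 2 * (2 * n ^ 2 * C)))).
    by rewrite leq_mul2l (leq_trans hlow) ?orbT // leq_mul2l hup orbT.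
  by rewrite /D; apply: eq_leq; move: (C); clear => c; lia.
have : n <= D * (g + 4 * D * (q + 2 * t)).
  by rewrite -(leq_pmul2l n0); move: hlu; clear; nia.
move: hg2 hn D0 tK; rewrite -/D -/n /q; move: (D) (g) (n); clear => D g n; nia.
Qed.

End Reach.

(** * Ordered graphs: ranks, induced paths, bicliques and triples *)

Section OrderedGraph.

Variables (d : Order.disp_t) (V : finOrderType d) (e : rel V).

Definition rank (x : V) := #|[set y | (y < x)%O]|.

Lemma rank_lt x y : (rank x < rank y) = (x < y)%O.
Proof.
have [xy|yx] := ltP x y; last first.
  apply/negbTE; rewrite -leqNgt; apply: subset_leq_card; apply/subsetP => z.
  by rewrite !inE => /lt_le_trans; apply.
apply: proper_card; apply/properP; split.
  by apply/subsetP => z; rewrite !inE => /lt_trans; apply.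
by exists x; rewrite inE ?ltxx.
Qed.

Lemma rank_inj : injective rank.
Proof.
by move=> x y exy; case: (ltgtP x y) => // h; move: h; rewrite -rank_lt exy ltnn.
Qed.

Lemma rank_lt_card x : rank x < #|V|.
Proof.
rewrite -cardsT; apply: proper_card; apply/properP; split; first exact: subsetT.
by exists x; rewrite ?inE ?ltxx.
Qed.

Definition forward : rel V := fun x y => (x < y)%O && e x y.

Hypothesis simple_e : simple_graph e.

(** The five vertices increase, so a missing forward edge is a non-edge of [e]; symmetry gives the
    reverse pairs. *)
Lemma induced_path5 x1 x2 x3 x4 x5 :
  forward x1 x2 -> forward x2 x3 -> forward x3 x4 -> forward x4 x5 ->
  ~~ forward x1 x3 -> ~~ forward x1 x4 -> ~~ forward x1 x5 ->
  ~~ forward x2 x4 -> ~~ forward x2 x5 -> ~~ forward x3 x5 ->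
  has_induced_monotone_path e 5.
Proof.
rewrite /forward => /andP[l12 e12] /andP[l23 e23] /andP[l34 e34] /andP[l45 e45].
have l13 := lt_trans l12 l23; have l24 := lt_trans l23 l34.
have l35 := lt_trans l34 l45; have l14 := lt_trans l13 l34.
have l25 := lt_trans l24 l45; have l15 := lt_trans l14 l45.
rewrite l13 l14 l15 l24 l25 l35 /= => n13 n14 n15 n24 n25 n35.
case: simple_e => sym irr.
have E := (e12, e23, e34, e45, negbTE n13, negbTE n14, negbTE n15, negbTE n24,
  negbTE n25, negbTE n35).
have E' := (sym x2 x1, sym x3 x1, sym x4 x1, sym x5 x1, sym x3 x2, sym x4 x2,
  sym x5 x2, sym x4 x3, sym x5 x3, sym x5 x4).
exists (fun i => nth x1 [:: x1; x2; x3; x4; x5] i); split.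
  by move=> [[|[|[|[|[|i]]]]] hi] [[|[|[|[|[|j]]]]] hj].
move=> [[|[|[|[|[|i]]]]] hi] [[|[|[|[|[|j]]]]] hj] //=;
  by rewrite ?E' ?irr ?E; split.
Qed.

(** Injectivity needs [A] and [B] disjoint, which holds because [compl_graph e] is irreflexive. *)
Lemma biclique_copy t (A B : {set V}) : t <= #|A| -> t <= #|B| ->
  (forall x y, x \in A -> y \in B -> compl_graph e x y) ->
  contains_copy (compl_graph e) (blowup (complete_graph 2) t).
Proof.
move=> hA hB h; case: simple_e => sym _.
pose g (p : 'I_2 * 'I_t) : V :=
  if p.1 == ord0 then enum_val (widen_ord hA p.2) else enum_val (widen_ord hB p.2).
have hS x y : compl_graph e x y = compl_graph e y x.
  by rewrite /compl_graph eq_sym sym.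
have hg (i j : 'I_2) k l : i != j -> compl_graph e (g (i, k)) (g (j, l)).
  rewrite /g /=; have [i0|i0] := eqVneq i ord0; have [j0|j0] := eqVneq j ord0.
  - by rewrite i0 j0.
  - by move=> _; apply: h; apply: enum_valP.
  - by move=> _; rewrite hS; apply: h; apply: enum_valP.
  - move=> /eqP[]; apply: val_inj; move: i j i0 j0.
    by move=> [[|[|i]] hi] [[|[|j]] hj].
exists g; split; last by move=> [i k] [j l]; apply: hg.
move=> [i k] [j l] E.
have [eij|nij] := eqVneq i j; last first.
  by have := hg i j k l nij; rewrite E /compl_graph eqxx.
subst j; congr (_, _); move: E; rewrite /g /=.
by case: eqP => _ /enum_val_inj/(congr1 val) /= ?; apply: val_inj.
Qed.

(** Sorting an independent 3-set yields a triple whose image is that set. *)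
Lemma clique3_le :
  #|cliques (compl_graph e) 3| <= \sum_z \sum_w #|apexes forward rank z w|.
Proof.
pose T := [set p : V * V * V | indep3 forward rank p.2 p.1.1 p.1.2].
have -> : \sum_z \sum_w #|apexes forward rank z w| = #|T|.
  rewrite pair_bigA /= -sum_nat_card.
  rewrite -(pair_bigA _ (fun p u => indep3 forward rank u p.1 p.2 : nat)) /=.
  by apply: eq_bigr => p _; rewrite sum_nat_card.
apply: leq_trans (leq_imset_card (fun p : V * V * V => [set x in [:: p.2; p.1.1; p.1.2]]) _).
apply: subset_leq_card; apply/subsetP => A; rewrite inE => /andP[/eqP cA hA].
pose s := sort (fun x y => (x <= y)%O) (enum A).
have hs : size s = 3 by rewrite size_sort -cardE.
have ms x : (x \in s) = (x \in A) by rewrite mem_sort mem_enum.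
have ss : sorted (fun x y => (x < y)%O) s.
  by rewrite lt_sorted_uniq_le sort_uniq enum_uniq sort_le_sorted.
have hn x y : x \in s -> y \in s -> (x < y)%O -> ~~ e x y.
  rewrite !ms lt_neqAle => xA yA /andP[xy _].
  by have /forall_inP/(_ x xA)/forall_inP/(_ y yA)/implyP/(_ xy)/andP[] := hA.
case: s hs ms ss hn => [|u [|z [|w []]]] //= _ ms /and3P[uz zw _] hn.
apply/imsetP; exists (z, w, u).
  rewrite inE /indep3 !rank_lt uz zw /= /forward !negb_and.
  by rewrite !hn ?orbT ?inE ?eqxx ?orbT // (lt_trans uz).
by apply/setP => x; rewrite inE -ms.
Qed.

End OrderedGraph.

(** The ratio of the two quantities is largest at [n = 3], where it equals 27. *)
Lemma cube_le_binomial3 n : 2 < n -> n ^ 3 <= 27 * 'C(n, 3).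
Proof.
move=> hn; have := bin_ffact n 3; rewrite !ffactnS ffactn0 muln1 -!subn1 => h.
have h6 : 3`! = 6 by []; rewrite h6 in h.
rewrite -(leq_pmul2l (isT : 0 < 6)) mulnCA (mulnC 6 'C(_, _)) h.
by case: n hn {h} => [|[|[|n]]] // _; nia.
Qed.

(** * Choice of constants and conclusion *)

Local Open Scope ring_scope.

Theorem theorem1p2 (R : realType) (eps : R) (heps : 0 < eps) :
  exists c : R, 0 < c /\
    forall (d : Order.disp_t) (V : finOrderType d) (e : rel V) (n : nat),
      simple_graph e ->
      #|V| = n ->
      ~ has_induced_monotone_path e 5 ->
      eps < clique_density R (compl_graph e) 3 ->
      contains_copy (compl_graph e)
        (blowup (complete_graph 2) (Num.truncn (c * n%:R / ln n%:R))).
Proof.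
(* Chosen so that, with [cube_le_binomial3], density above [eps] forces at least [n ^ 3 / m]
   independent triples. *)
pose m := (Num.truncn (27 / eps)).+1.
have hm : 27 < m%:R * eps by rewrite -ltr_pdivrMr // truncnS_gt.
move eb : (32 * (384 * m ^ 3) ^ 2)%N => b.
have b0 : (0 < b)%N by rewrite -eb muln_gt0 expn_gt0 muln_gt0 expn_gt0.
have bR0 : 0 < b%:R :> R by rewrite ltr0n.
have ln2 : 0 < ln 2 :> R by rewrite ln_gt0 // ltr1n.
(* [ln 2] passes to base 2, [b] is the constant required by [few_indep3], and 4 absorbs
   [L + 3 <= 4 * L]. *)
exists (ln 2 / (4 * b%:R)); split; first by rewrite divr_gt0 // mulr_gt0.
move=> d V e n simp cV noP5 dens.
set t := Num.truncn _.
have [/existsP[A /existsP[B /and3P[hA hB /forall_inP h]]]|nobic] :=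
  boolP [exists A : {set V}, exists B : {set V},
    [&& (t <= #|A|)%N, (t <= #|B|)%N &
      [forall x in A, forall y in B, compl_graph e x y]]].
  apply: (biclique_copy simp hA hB) => x y xA yB.
  by have /forall_inP := h x xA; apply.
exfalso.
(* On at most two vertices the binomial vanishes and the density is 0 by convention. *)
have n3 : (2 < n)%N.
  rewrite ltnNge; apply: contraTN dens => hn.
  by rewrite /clique_density cV bin_small // invr0 mulr0 -leNgt ltW.
(* For [t = 0] two empty sets would form a biclique. *)
have t0 : (0 < t)%N.
  rewrite lt0n; apply: contraNneq nobic => ->.
  apply/existsP; exists set0; apply/existsP; exists set0.
  by apply/and3P; split => //; apply/forall_inP => x; rewrite inE.
have cl : (n ^ 3 <= m * #|cliques (compl_graph e) 3|)%N.
  apply: leq_trans (cube_le_binomial3 n3) _.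
  have C0 : 0 < 'C(n, 3)%:R :> R by rewrite ltr0n bin_gt0.
  move: dens; rewrite /clique_density cV ltr_pdivlMr // => dens.
  rewrite -(ler_nat R) !natrM; apply: (@le_trans _ _ (m%:R * (eps * 'C(n, 3)%:R))).
    by rewrite mulrA ler_pM2r // ltW.
  by rewrite ler_pM2l ?ltr0n // ltW.
pose L := trunc_log 2 n.
have L1 : (0 < L)%N by rewrite trunc_log_gt0 //; lia.
have nR : 1 < n%:R :> R by rewrite ltr1n; lia.
have lnn : 0 < ln n%:R :> R by rewrite ln_gt0.
have hL : L%:R * ln 2 <= ln n%:R :> R.
  rewrite mulr_natl -lnXn // ler_ln ?posrE ?exprn_gt0 // ?(lt_trans ltr01) //.
  by rewrite -natrX ler_nat trunc_logP //; lia.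
have ht : t%:R * ln n%:R <= ln 2 / (4 * b%:R) * n%:R :> R.
  rewrite -ler_pdivlMr // truncn_le // divr_ge0 ?(ltW lnn) // mulr_ge0 ?ler0n //.
  by rewrite divr_ge0 ?mulr_ge0 ?ler0n // ltW.
have bt : (b * (t * L.+3) <= #|V|)%N.
  have h4 : (4 * b * t * L <= n)%N.
    rewrite -(ler_nat R) -(ler_pM2l ln2) !natrM.
    have b4 : 0 < 4 * b%:R :> R by rewrite mulr_gt0.
    move: ht; rewrite mulrAC ler_pdivlMr // => ht.
    apply: le_trans ht.
    rewrite [leRHS](_ : _ = (4 * b%:R * t%:R) * ln n%:R); last by ring.
    rewrite [leLHS](_ : _ = (4 * b%:R * t%:R) * (L%:R * ln 2)); last by ring.
    by rewrite ler_wpM2l // mulr_ge0 // ltW.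
  have L4 : (L.+3 <= 4 * L)%N by move: L1; clear; lia.
  rewrite cV; apply: leq_trans h4.
  rewrite (_ : 4 * b * t * L = b * (t * (4 * L)))%N; last by move: (b) (t) (L); clear; lia.
  by rewrite !leq_mul2l L4 !orbT.
rewrite -eb in bt.
have fwd x y : forward e x y -> (rank x < rank y)%N.
  by rewrite rank_lt => /andP[].
(* Here [K] is [L + 1], whence the [L + 3] in [bt]. *)
have cK : (#|V| <= 2 ^ L.+1)%N by rewrite cV ltnW // trunc_log_ltn.
have noP x1 x2 x3 x4 x5 : forward e x1 x2 -> forward e x2 x3 ->
    forward e x3 x4 -> forward e x4 x5 ->
    ~~ forward e x1 x3 -> ~~ forward e x1 x4 -> ~~ forward e x1 x5 ->
    ~~ forward e x2 x4 -> ~~ forward e x2 x5 -> ~~ forward e x3 x5 -> False.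
  move=> f12 f23 f34 f45 n13 n14 n15 n24 n25 n35; apply: noP5.
  exact: (induced_path5 simp f12 f23 f34 f45).
have nob (A B : {set V}) : (t <= #|A|)%N -> (t <= #|B|)%N ->
    (forall x y, x \in A -> y \in B -> (rank x < rank y)%N) ->
    exists x y, [/\ x \in A, y \in B & forward e x y].
  move=> hA hB lAB.
  case: (boolP [exists x in A, exists y in B, e x y]).
    case/exists_inP => x xA /exists_inP[y yB exy].
    by exists x, y; split => //; rewrite /forward -rank_lt lAB.
  move=> hno; case/existsP: nobic; exists A; apply/existsP; exists B; rewrite hA hB /=.
  apply/forall_inP => x xA; apply/forall_inP => y yB; apply/andP; split.
    by apply: contraTneq (lAB _ _ xA yB) => ->; rewrite ltnn.
  apply: contraNN hno => exy; apply/exists_inP; exists x => //.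
  by apply/exists_inP; exists y.
have := few_indep3 (m := m) (@rank_inj d V) fwd t0 nob cK noP (@rank_lt_card d V) isT bt.
rewrite cV ltnNge (leq_trans cl) // leq_mul2l.
exact: clique3_le.
Qed.
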